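(* Let $\varepsilon(n)=\frac{16(\log n)^{0.8}}{n}$. If $p=p(n)\in[0,1]$ satisfies $p\ge\frac{4\log n}{n}+\varepsilon(n)$, then a random temporal graph $\mathcal G\sim\mathcal F_{n,p}$ a.a.s. has an optimal spanner, i.e., a temporal spanner with exactly $2n-4$ edges.
   Context: A simple temporal graph is a pair $(G,\lambda)$ where $G=(V,E)$ is a finite simple undirected graph and $\lambda:E\to\mathbb R$ assigns a single time label to each edge. A temporal $(u,v)$-path is a path $u=u_0,\dots,u_\ell=v$ in $G$ with $\lambda(u_0u_1)\le\dots\le\lambda(u_{\ell-1}u_\ell)$. A temporal graph is temporally connected if every vertex has a temporal path to every other vertex. A temporal subgraph of $(G,\lambda)$ is $(G',\lambda|_{E(G')})$ with $G'$ a subgraph of $G$; a (temporal) spanner of $(G,\lambda)$ is a temporal subgraph with $V(G')=V(G)$ which is temporally connected. For $n\in\mathbb N$ and $p\in[0,1]$, the model $\mathcal F_{n,p}$: draw $G$ from the Erdős–Rényi model $G_{n,p}$ on $n$ labelled vertices and give each edge of $G$ an independent time label uniform in $[0,1]$. $\log$ is the natural logarithm; a.a.s. means with probability tending to $1$ as $n\to\infty$. *)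

(* Defs.v *)
From HB Require Import structures.
From mathcomp Require Import all_boot all_order all_algebra.
From mathcomp Require Import all_classical all_reals all_analysis.
Set Implicit Arguments.
Unset Strict Implicit.
Unset Printing Implicit Defensive.
Import Order.TTheory GRing.Theory Num.Theory.
Import numFieldNormedType.Exports.
Local Open Scope classical_set_scope.
Local Open Scope ring_scope.

Record sgraph (V : finType) := SGraph {
  edges : {set {set V}};
  edges_card2 : forall e, e \in edges -> #|e| = 2%N }.

Definition adj (V : finType) (G : sgraph V) : rel V :=
  fun x y => [set x; y]%SET \in edges G.

(* The labelling is a total function of the vertex subset, but its values
   outside the edge set are junk and are never looked at below. *)
Record tgraph (V : finType) (R : realType) := TGraph {
  graph :> sgraph V;
  label : {set V} -> R }.

(* u :: s is the vertex sequence u_0, ..., u_l. *)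
Definition temporal_path (V : finType) (R : realType) (G : tgraph V R)
    (u v : V) (s : seq V) : Prop :=
  [/\ path (adj G) u s, last u s = v, uniq (u :: s) &
      sorted <=%R (pairmap (fun x y => label G [set x; y]%SET) u s)].

Definition temporally_connected (V : finType) (R : realType)
    (G : tgraph V R) : Prop :=
  forall u v : V, u != v -> exists s : seq V, temporal_path G u v s.

(* H and G share the vertex type V, hence a temporal subgraph on V is
   automatically spanning. *)
Definition spanner (V : finType) (R : realType) (G H : tgraph V R) : Prop :=
  [/\ edges H \subset edges G,
      {in edges H, label H =1 label G} &
      temporally_connected H].

Definition has_optimal_spanner (V : finType) (R : realType)
    (G : tgraph V R) : Prop :=
  exists2 H : tgraph V R, spanner G H & #|edges H| = (2 * #|V| - 4)%N.

(* Law of the Erdos-Renyi random graph on the vertex set 'I_n. *)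
Definition gnp_pmf (R : realType) (n : nat) (p : R) (g : sgraph 'I_n) : R :=
  p ^+ #|edges g| * (1 - p) ^+ ('C(n, 2) - #|edges g|).

(* G, a random element on (T, P), is distributed as F_{n,p}: the underlying
   graph has law G_{n,p} and, conditionally on it being g, the labels of the
   edges of g are independent and uniform in [0, 1]. *)
Record is_Fnp d (T : measurableType d) (R : realType) (P : probability T R)
    (n : nat) (p : R) (G : T -> tgraph 'I_n R) : Prop := IsFnp {
  Fnp_measurable_graph : forall g : sgraph 'I_n,
    measurable [set w | edges (G w) = edges g];
  Fnp_measurable_label : forall e : {set 'I_n},
    measurable_fun [set w | e \in edges (G w)] (fun w => label (G w) e);
  Fnp_graph : forall g : sgraph 'I_n,
    P [set w | edges (G w) = edges g] = (gnp_pmf p g)%:E;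
  Fnp_label : forall (g : sgraph 'I_n) (B : {set 'I_n} -> set R),
    (forall e, measurable (B e)) ->
    P [set w | edges (G w) = edges g /\
               forall e, e \in edges g -> B e (label (G w) e)] =
    (P [set w | edges (G w) = edges g] *
     \prod_(e in edges g) uniform_prob (@ltr01 R) (B e))%E }.

Definition epsilon (R : realType) (n : nat) : R :=
  16 * (ln n%:R `^ (4 / 5)) / n%:R.

(* Main.v *)
(* Discretise time into an initial phase, two short middle cells A, B and a
   final phase.  Suppose a 4-cycle has edges labelled alternately in A, B, A, B,
   every vertex reaches the cycle during the initial phase, and every vertex is
   reached from it during the final phase.  The two forests witnessing this have
   n - 4 edges each and together with the 4 cycle edges form a spanner: within
   the cycle every vertex reaches every other by an A-edge followed by a B-edge.

   The set U of vertices reached from a 4-set by time t is a growth process: in a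
   cell of mass h it gains a vertex with probability about h |U| (n - |U|).  The
   potential (n - k) / (k - 1) is an eigenfunction of this chain with eigenvalue
   -(n - 1), so its mean after total mass t is at most about
   (n / 3) exp (- (n - 1) t), whereas it is at least 1 / (n - 2) as long as some
   vertex is missed.  Hence each phase succeeds once n t = 2 ln n + 4 (ln n)^0.8.

   The middle cells have mass q = 4 (ln n)^0.8 / n each.  Take 4-cycles with one
   vertex in each of four classes of size m = n / 4: two of them that agree in r
   classes share at most r edges, so the number of alternately labelled ones has
   mean (m q)^4 and second moment at most (m q (1 + m q))^4, and m q tends to
   infinity.  The growth from a given 4-set does not depend on the states of the
   edges inside it.  All masses add up to (4 ln n + 16 (ln n)^0.8) / n. *)

Require Import Defs.
From HB Require Import structures.
From mathcomp Require Import all_boot all_order all_algebra.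
From mathcomp Require Import all_classical all_reals all_analysis.
From mathcomp Require Import ring lra zify.
Import Order.TTheory GRing.Theory Num.Theory.
Import numFieldNormedType.Exports.
Set Implicit Arguments.
Unset Strict Implicit.
Unset Printing Implicit Defensive.
Local Open Scope ring_scope.

(** * Product weights *)

Section ProductWeight.
Context {R : realFieldType} {I S : finType}.
Implicit Types (nu : I -> S -> R) (s : {ffun I -> S}) (t : I -> S) (c : S).
Implicit Types (D B : {set I}) (A : I -> pred S).
Implicit Types (F : {ffun I -> S} -> R) (E : pred {ffun I -> S}).

(* [nu] need not be normalised, so that conditioning on a product event amounts
   to restricting [nu]. *)
Definition expect nu F : R := \sum_(s : {ffun I -> S}) (\prod_i nu i (s i)) * F s.

Definition weight nu E : R := expect nu (fun s => (E s)%:R).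

Definition box A : pred {ffun I -> S} := fun s => [forall i, A i (s i)].

Definition restrict_weight nu A i y : R := nu i y * (A i y)%:R.

Lemma eq_expect nu F1 F2 : F1 =1 F2 -> expect nu F1 = expect nu F2.
Proof. by move=> F12; apply: eq_bigr => s _; rewrite F12. Qed.

Lemma expectD nu F1 F2 :
  expect nu (fun s => F1 s + F2 s) = expect nu F1 + expect nu F2.
Proof. by rewrite -big_split; apply: eq_bigr => s _; rewrite mulrDr. Qed.

Lemma expectZ nu (a : R) F : expect nu (fun s => a * F s) = a * expect nu F.
Proof. by rewrite mulr_sumr; apply: eq_bigr => s _; rewrite mulrCA. Qed.

Lemma expect_sum nu (J : finType) (F : J -> {ffun I -> S} -> R) :
  expect nu (fun s => \sum_j F j s) = \sum_j expect nu (F j).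
Proof. by rewrite exchange_big; apply: eq_bigr => s _; rewrite mulr_sumr. Qed.

Lemma expect_cst nu (a : R) : expect nu (fun=> a) = a * weight nu predT.
Proof. by rewrite -expectZ; apply: eq_expect => s; rewrite mulr1. Qed.

Lemma ler_expect nu F1 F2 : (forall i y, 0 <= nu i y) ->
  (forall s, F1 s <= F2 s) -> expect nu F1 <= expect nu F2.
Proof.
by move=> nu0 F12; apply: ler_sum => s _; apply: ler_wpM2l => //; apply: prodr_ge0.
Qed.

Lemma weight_ge0 nu E : (forall i y, 0 <= nu i y) -> 0 <= weight nu E.
Proof. by move=> nu0; apply: sumr_ge0 => s _; rewrite mulr_ge0 ?prodr_ge0. Qed.

Lemma weight_box nu A : weight nu (box A) = \prod_i \sum_(y | A i y) nu i y.
Proof.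
rewrite bigA_distr_big_dep [RHS]big_mkcond; apply: eq_bigr => s _.
by rewrite mulr_natr mulrb.
Qed.

Lemma weightT nu : weight nu predT = \prod_i \sum_y nu i y.
Proof. by rewrite bigA_distr_bigA; apply: eq_bigr => s _; rewrite mulr1. Qed.

Lemma expect_restrict nu A F :
  expect (restrict_weight nu A) F = expect nu (fun s => (box A s)%:R * F s).
Proof.
apply: eq_bigr => s _; rewrite mulrA big_split; congr (_ * _ * _) => /=.
rewrite /box; case: forallP => [As|/forallP]; first by rewrite big1 // => i _; rewrite As.
rewrite negb_forall => /existsP[i nAi].
by rewrite (bigD1 i) //= (negbTE nAi) mul0r.
Qed.

Lemma weight_restrict nu A E :
  weight (restrict_weight nu A) E = weight nu (fun s => box A s && E s).
Proof. by rewrite [LHS]expect_restrict; apply: eq_expect => s; rewrite -natrM mulnb. Qed.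

Definition hits D c s : {set I} := [set i in D | s i == c].

Definition hits_exactly D c B i : pred S :=
  fun y => (i \in D) ==> ((y == c) == (i \in B)).

Definition given_hits nu D c B : I -> S -> R :=
  restrict_weight nu (hits_exactly D c B).

Lemma hits_eqE D c B s : B \subset D -> (hits D c s == B) = box (hits_exactly D c B) s.
Proof.
move=> BD; apply/eqP/forallP => [<- i|sB]; first by apply/implyP => iD; rewrite inE iD.
apply/setP => i; rewrite inE; have := sB i; rewrite /hits_exactly.
case: (boolP (i \in D)) => /= [_ /eqP //|iD _].
by apply/esym/negbTE; apply: contra iD; apply: (fintype.subsetP BD).
Qed.

Lemma expect_hits nu D c F :
  expect nu F =
  \sum_(B : {set I} | B \subset D) expect (given_hits nu D c B) F.
Proof.
rewrite /expect (partition_big (hits D c) (fun B : {set I} => B \subset D)) /=; last first.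
  by move=> s _; apply/fintype.subsetP => i; rewrite inE => /andP[].
apply: eq_bigr => B BD; rewrite [RHS]expect_restrict big_mkcond.
by apply: eq_bigr => s _; rewrite -hits_eqE //; case: eqP; rewrite ?(mul1r, mul0r, mulr0).
Qed.

Lemma eq_expect_hits nu D c B F1 F2 : B \subset D ->
  (forall s, hits D c s = B -> F1 s = F2 s) ->
  expect (given_hits nu D c B) F1 =
  expect (given_hits nu D c B) F2.
Proof.
move=> BD F12; rewrite /given_hits !expect_restrict; apply: eq_expect => s.
by rewrite -hits_eqE //; case: eqP => [/F12 ->|] //; rewrite !mul0r.
Qed.

Definition share_ge nu (h : R) i c : Prop := h * \sum_y nu i y <= nu i c.

Lemma weight_hits0_le nu (h : R) D c :
  (forall i y, 0 <= nu i y) -> (forall i, i \in D -> share_ge nu h i c) ->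
  weight nu (fun s => hits D c s == finset.set0) <= (1 - h) ^+ #|D| * weight nu predT.
Proof.
move=> nu0 hD; have -> : weight nu (fun s => hits D c s == finset.set0) =
    weight nu (box (hits_exactly D c finset.set0)).
  by apply: eq_expect => s; rewrite hits_eqE // finset.sub0set.
rewrite weight_box weightT -prodr_const [X in X * _]big_mkcond -big_split.
apply: ler_prod => i _; rewrite sumr_ge0 //=; case: ifPn => iD; last first.
  by rewrite mul1r /hits_exactly (negbTE iD).
have -> : \sum_(y | hits_exactly D c finset.set0 i y) nu i y = \sum_(y | y != c) nu i y.
  by apply: eq_bigl => y; rewrite /hits_exactly iD inE eqbF_neg.
by have := hD i iD; rewrite /share_ge (bigD1 c) //=; lra.
Qed.

Definition agree_on D t : pred {ffun I -> S} := box (fun i y => (i \in D) ==> (y == t i)).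

Lemma weight_agree_on nu D t : (forall i, \sum_y nu i y = 1) ->
  weight nu (agree_on D t) = \prod_(i in D) nu i (t i).
Proof.
move=> nu1; rewrite weight_box [RHS]big_mkcond; apply: eq_bigr => i _.
by case: (i \in D); [rewrite big_pred1_eq|rewrite nu1].
Qed.

Lemma agree_onU D1 D2 t s :
  agree_on (D1 :|: D2) t s = agree_on D1 t s && agree_on D2 t s.
Proof.
apply/forallP/andP => [st|[/forallP st1 /forallP st2] i].
  by split; apply/forallP => i; apply/implyP => iD;
    have := st i; rewrite inE iD ?orbT.
by have := st1 i; have := st2 i; rewrite inE; case: (i \in D1); case: (i \in D2).
Qed.

(* Pointwise, [2 Z / l - (X / l)^2 <= 2 Z / l - (Z / l)^2 <= 1]. *)
Lemma weight_neq0_ge nu (X Z : {ffun I -> S} -> R) (l : R) :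
  (forall i y, 0 <= nu i y) -> 0 < l -> (forall s, 0 <= Z s <= X s) ->
  2 / l * expect nu Z - l ^- 2 * expect nu (fun s => X s ^+ 2) <=
  weight nu (fun s => Z s != 0).
Proof.
move=> nu0 l0 ZX; rewrite -mulNr -!expectZ -expectD; apply: ler_expect => // s.
have : 0 < l^-1 by rewrite invr_gt0.
rewrite -exprVn; move: (l^-1) => k k0; have /andP[Z0 ZleX] := ZX s.
case: eqVneq => [->|_ /=].
  by rewrite mulr0 add0r mulNr oppr_le0 mulr_ge0 ?sqr_ge0.
by have := sqr_ge0 (k * X s - 1); nra.
Qed.

End ProductWeight.

(** * Growth of the reached set *)

Section Potential.
Context {R : realFieldType}.
Implicit Types (n k : nat) (h : R).

Definition potential n k : R := (n%:R - k%:R) / (k%:R - 1).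

Definition decay n h : R := 1 - (n%:R - 1) * h / (1 + n%:R ^+ 2 * h).

Lemma decay_ge0 n h : 0 <= h -> 0 <= decay n h.
Proof.
move=> h0; have n2h : 0 <= n%:R ^+ 2 * h by rewrite mulr_ge0 ?sqr_ge0.
rewrite subr_ge0 ler_pdivrMr ?mul1r; last lra.
have : n%:R - 1 <= n%:R ^+ 2 :> R by nra.
by move/(ler_wpM2r h0); lra.
Qed.

Lemma potential_ge0 n k : (1 < k <= n)%N -> 0 <= potential n k.
Proof.
case/andP => k1 kn; rewrite divr_ge0 ?subr_ge0 ?ler_nat //.
by rewrite -[1]/(1%:R) ler_nat ltnW.
Qed.

Lemma potential_le n k : (1 < k)%N -> potential n k <= n%:R.
Proof.
move=> k1; have k2 : 2 <= k%:R :> R by rewrite ler_nat.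
by rewrite ler_pdivrMr; [have := ler0n R n; nra|lra].
Qed.

Lemma mulr_potential_ge1 n k : (1 < k < n)%N -> 1 <= n%:R * potential n k.
Proof.
case/andP => k1 kn; have k2 : 2 <= k%:R :> R by rewrite ler_nat.
have nk : k%:R + 1 <= n%:R :> R by rewrite natr1 ler_nat.
by rewrite mulrA ler_pdivlMr; [nra|lra].
Qed.

Lemma potential_homo n k l : (1 < k <= n)%N -> (k <= l)%N ->
  potential n l <= potential n k.
Proof.
case/andP => k1 kn kl; have k2 : 2 <= k%:R :> R by rewrite ler_nat.
have [kn' kl'] : k%:R <= n%:R :> R /\ k%:R <= l%:R :> R by rewrite !ler_nat.
rewrite ler_pdivrMr; last lra.
by rewrite mulrAC ler_pdivlMr; [nra|lra].
Qed.

(* [potential n] is an eigenfunction of the birth chain [k -> k + 1] of rate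
   [k * (n - k)], with eigenvalue [- (n - 1)]. *)
Lemma potential_diff n k : (1 < k)%N ->
  (potential n k - potential n k.+1) * (k%:R * (n%:R - k%:R)) =
  (n%:R - 1) * potential n k.
Proof.
move=> k1; have k2 : 2 <= k%:R :> R by rewrite ler_nat.
rewrite /potential -addn1 natrD /=; field.
by rewrite !gt_eqF //; lra.
Qed.

Lemma exprn_onem_le_inv h m : 0 <= h <= 1 -> (1 - h) ^+ m <= (1 + m%:R * h)^-1.
Proof.
case/andP => h0 h1; have mh k : 0 <= k%:R * h by rewrite mulr_ge0.
have pos k : 0 < 1 + k%:R * h by rewrite ltr_pwDl.
rewrite -[leRHS]mul1r ler_pdivlMr //.
elim: m => [|m IH]; first by rewrite expr0 mul0r addr0 mul1r.
rewrite exprSr -mulrA; apply: le_trans IH; apply: ler_wpM2l.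
  by apply: exprn_ge0; lra.
by have := mh m; rewrite -addn1 natrD; nra.
Qed.

Lemma potential_drift n k h : 0 <= h <= 1 -> (1 < k <= n)%N ->
  potential n k.+1 + (potential n k - potential n k.+1) * (1 - h) ^+ (k * (n - k)) <=
  decay n h * potential n k.
Proof.
move=> h01 kn; have [h0 h1] := andP h01; have [k1 kln] := andP kn.
have diff_ge0 : 0 <= potential n k - potential n k.+1 by rewrite subr_ge0 potential_homo.
set m := (k * (n - k))%N.
have mE : m%:R = k%:R * (n%:R - k%:R) :> R by rewrite natrM natrB.
have mh_ge0 : 0 <= m%:R * h by rewrite mulr_ge0.
have mh_le : m%:R * h <= n%:R ^+ 2 * h.
  by rewrite ler_wpM2r // -natrX ler_nat /m mulnC leq_mul ?leq_subr.
have -> : decay n h * potential n k = potential n k -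
    (potential n k - potential n k.+1) * (m%:R * h / (1 + n%:R ^+ 2 * h)).
  by rewrite mE -(mulrA (_ * _)) [X in _ - X]mulrA potential_diff // /decay; ring.
have stay : (1 - h) ^+ m <= 1 - m%:R * h / (1 + n%:R ^+ 2 * h).
  apply: le_trans (exprn_onem_le_inv m h01) _.
  move: (m%:R * h) (_ ^+ 2 * h) mh_ge0 mh_le => x y x0 xy.
  have -> : (1 + x)^-1 = 1 - x / (1 + x) by field; rewrite gt_eqF //; lra.
  by rewrite lerD2l lerN2 ler_wpM2l // lef_pV2 ?posrE ?lerD2l //; lra.
have := ler_wpM2l diff_ge0 stay; lra.
Qed.

End Potential.

Section Growth.
Context {R : realFieldType} {V S : finType}.
Implicit Types (U : {set V}) (s : {ffun {set V} -> S}) (c : S) (cs : seq S).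
Implicit Types (nu : {set V} -> S -> R) (e : {set V}) (B : {set {set V}}).

Definition grow_step s U c : {set V} :=
  U :|: [set v | [exists u in U, s [set u; v] == c]].

Definition grow s cs U : {set V} := foldl (grow_step s) U cs.

Definition cut U : {set {set V}} :=
  [set [set x.1; x.2] | x in finset.setX U (~: U)].

Lemma cutP U e :
  reflect (exists u v, [/\ u \in U, v \notin U & e = [set u; v]]) (e \in cut U).
Proof.
apply: (iffP imsetP) => [[[u v]]|[u [v [uU vU ->]]]].
  by rewrite !inE /= => /andP[uU vU] ->; exists u, v.
by exists (u, v); rewrite ?inE /= ?uU.
Qed.

Lemma card_cut U : #|cut U| = (#|U| * (#|V| - #|U|))%N.
Proof.
rewrite card_in_imset; first by rewrite cardsX [#|~: U|]cardsCs finset.setCK.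
move=> [u v] [u' v']; rewrite !inE /= => /andP[uU vU] /andP[u'U v'U] /setP E.
have := E u; have := E v; rewrite !inE !eqxx ?orbT /=.
have -> : (v == u') = false by apply: contraNF vU => /eqP->.
have -> : (u == v') = false by apply: contraNF v'U => /eqP<-.
by rewrite orbF /= => /esym/eqP -> /esym/eqP ->.
Qed.

Lemma cards2_cut U e : e \in cut U -> #|e| = 2%N.
Proof.
case/cutP => u [v [uU vU ->]]; rewrite cards2 (_ : u != v) //.
by apply: contraNneq vU => <-.
Qed.

Lemma cut_not_sub U e : e \in cut U -> ~~ (e \subset U).
Proof.
case/cutP => u [v [_ vU ->]]; apply: contra vU => /fintype.subsetP; apply.
by rewrite !inE eqxx orbT.
Qed.

Lemma sub_grow_step s U c : U \subset grow_step s U c.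
Proof. exact: finset.subsetUl. Qed.

Lemma sub_grow s cs U : U \subset grow s cs U.
Proof.
elim: cs U => //= c cs IH U.
exact: fintype.subset_trans (sub_grow_step s U c) (IH _).
Qed.

Lemma grow_stepE s U c : grow_step s U c = U :|: finset.cover (hits (cut U) c s).
Proof.
apply/setP => v; rewrite !inE; case: (boolP (v \in U)) => //= vU.
apply/existsP/finset.bigcupP => [[u /andP[uU suv]]|[e]].
  exists [set u; v]; rewrite ?inE ?eqxx ?orbT // suv andbT.
  by apply/cutP; exists u, v.
rewrite inE => /andP[/cutP[u [w [uU wU ->]]] sc].
rewrite !inE => /orP[]/eqP vE; first by rewrite vE uU in vU.
by exists u; rewrite uU vE.
Qed.

Definition share_outside nu (h : R) cs U : Prop :=
  forall e c, #|e| = 2%N -> ~~ (e \subset U) -> c \in cs -> share_ge nu h e c.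

(* The edges found in [c] lie inside the enlarged set, and the other cut edges
   only lose the state [c]. *)
Lemma share_outside_hits nu (h : R) c cs U B :
  (forall e y, 0 <= nu e y) -> 0 <= h -> c \notin cs -> share_outside nu h (c :: cs) U ->
  share_outside (given_hits nu (cut U) c B) h cs (U :|: finset.cover B).
Proof.
move=> nu0 h0 ccs nuU e c' e2 eUB c'cs.
have eU : ~~ (e \subset U).
  by apply: contra eUB => /fintype.subset_trans; apply; apply: finset.subsetUl.
have eB : e \notin B.
  by apply: contra eUB => eB; apply: finset.subsetU; rewrite finset.bigcup_sup ?orbT.
have c'c : c' != c by apply: contraNneq ccs => <-.
rewrite /share_ge; have -> : given_hits nu (cut U) c B e c' = nu e c'.
  rewrite /given_hits /restrict_weight /hits_exactly (negbTE eB) (negbTE c'c).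
  by rewrite implybT mulr1.
apply: le_trans (nuU e c' e2 eU (mem_behead (s := c :: cs) c'cs)).
apply: ler_wpM2l => //; apply: ler_sum => y _; rewrite -[leRHS]mulr1.
by apply: ler_wpM2l => //; case: hits_exactly.
Qed.

Section Expectation.
Variable h : R.
Hypothesis h01 : 0 <= h <= 1.
Local Notation n := #|V|.

Lemma expect_grow_step nu U c :
  (forall e y, 0 <= nu e y) -> (1 < #|U|)%N ->
  (forall e, e \in cut U -> share_ge nu h e c) ->
  expect nu (fun s => potential n #|grow_step s U c|) <=
  decay n h * potential n #|U| * weight nu predT.
Proof.
move=> nu0 U1 hcut; set k := #|U|; pose dp : R := potential n k - potential n k.+1.
have kn : (1 < k <= n)%N by rewrite U1 max_card.
have dp0 : 0 <= dp by rewrite subr_ge0 potential_homo.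
have step s : potential n #|grow_step s U c| <=
    potential n k.+1 + dp * (hits (cut U) c s == finset.set0)%:R.
  have [stay|grew] := eqVneq (grow_step s U c) U.
    have -> : hits (cut U) c s = finset.set0.
      apply/eqP; rewrite -finset.subset0; apply/fintype.subsetP => e eh.
      have := eh; rewrite inE => /andP[/cut_not_sub/negP[]].
      suff: e \subset grow_step s U c by rewrite stay.
      by rewrite grow_stepE; apply: finset.subsetU; rewrite finset.bigcup_sup ?orbT.
    by rewrite stay eqxx mulr1 addrC subrK.
  have kgrow : (k < #|grow_step s U c|)%N.
    by rewrite fintype.proper_card // finset.properEneq eq_sym grew sub_grow_step.
  rewrite -[leLHS]addr0 lerD ?mulr_ge0 // potential_homo //.
  by rewrite ltnS ltnW ?(leq_trans kgrow) ?max_card.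
apply: le_trans (ler_expect nu0 step) _; rewrite expectD expectZ expect_cst.
apply: le_trans
  (_ : _ <= (potential n k.+1 + dp * (1 - h) ^+ #|cut U|) * weight nu predT) _.
  by rewrite [leRHS]mulrDl lerD2l -mulrA ler_wpM2l // weight_hits0_le.
by rewrite ler_wpM2r ?weight_ge0 // card_cut potential_drift.
Qed.

Lemma expect_grow nu U cs :
  (forall e y, 0 <= nu e y) -> (1 < #|U|)%N -> uniq cs -> share_outside nu h cs U ->
  expect nu (fun s => potential n #|grow s cs U|) <=
  decay n h ^+ size cs * potential n #|U| * weight nu predT.
Proof.
have [h0 _] := andP h01.
elim: cs nu U => [|c cs IH] nu U nu0 U1 /=; first by rewrite expect_cst mul1r.
case/andP => ccs ucs nuU.
rewrite (expect_hits _ (cut U) c).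
apply: le_trans (_ : _ <= \sum_(B : {set {set V}} | B \subset cut U)
    expect (given_hits nu (cut U) c B)
      (fun s => decay n h ^+ size cs * potential n #|grow_step s U c|)) _.
  apply: ler_sum => B BU; set U' := U :|: finset.cover B.
  have growE s : hits (cut U) c s = B -> grow_step s U c = U' by rewrite grow_stepE => ->.
  rewrite [leLHS](eq_expect_hits _ BU
    (F2 := fun s => potential n #|grow s cs U'|)) => [|s /growE -> //].
  rewrite [leRHS](eq_expect_hits _ BU
    (F2 := fun=> decay n h ^+ size cs * potential n #|U'|)) => [|s /growE -> //].
  rewrite expect_cst; apply: IH => //; last exact: share_outside_hits.
    by move=> e y; rewrite mulr_ge0.
  exact: leq_trans U1 (subset_leq_card (finset.subsetUl _ _)).
rewrite -expect_hits expectZ exprSr -!(mulrA (_ ^+ _)) ler_wpM2l ?exprn_ge0 ?decay_ge0 //.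
apply: expect_grow_step => // e eU; apply: nuU; last exact: mem_head.
  exact: cards2_cut eU.
exact: cut_not_sub.
Qed.

Lemma weight_grow_neqT nu U cs :
  (forall e y, 0 <= nu e y) -> (1 < #|U|)%N -> uniq cs -> share_outside nu h cs U ->
  weight nu (fun s => grow s cs U != [set: V]) <=
  n%:R * (decay n h ^+ size cs * potential n #|U|) * weight nu predT.
Proof.
move=> nu0 U1 ucs nuU; rewrite -mulrA.
apply: le_trans (ler_wpM2l (ler0n _ _) (expect_grow nu0 U1 ucs nuU)).
rewrite -expectZ; apply: ler_expect => // s.
have gU : (1 < #|grow s cs U|)%N := leq_trans U1 (subset_leq_card (sub_grow s cs U)).
have [_|neT] := eqVneq; first by rewrite mulr_ge0 ?potential_ge0 ?gU ?max_card.
rewrite mulr_potential_ge1 // gU -cardsT proper_card //.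
by rewrite finset.properEneq neT finset.subsetT.
Qed.

End Expectation.

End Growth.

(** * Copies of a pattern *)

Lemma sum_ffun2_prod {R : comPzRingType} {J T : finType} (f : T -> T -> R) :
  \sum_(x : {ffun J -> T}) \sum_(x' : {ffun J -> T}) \prod_j f (x j) (x' j) =
  (\sum_y \sum_y' f y y') ^+ #|J|.
Proof.
under eq_bigr => x _ do rewrite -(bigA_distr_bigA (fun j y' => f (x j) y')).
by rewrite -(bigA_distr_bigA (fun j y => \sum_y' f y y')) prodr_const.
Qed.

Section PatternCopies.
Context {V J T : finType} (succ : J -> J) (emb : J * T -> V).
Hypotheses (succ_neq : forall j, succ j != j) (succ2_neq : forall j, succ (succ j) != j).
Hypothesis emb_inj : injective emb.
Implicit Types (x : {ffun J -> T}) (j : J) (e : {set V}).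

(* The pattern is the graph on [J] with an edge from each [j] to [succ j]; its
   copies have one vertex in each of the disjoint classes [emb (j, _)]. *)
Definition copy_vertices x : {set V} := [set emb (j, x j) | j : J].

Definition copy_edge x j : {set V} := [set emb (j, x j); emb (succ j, x (succ j))].

Definition copy_edges x : {set {set V}} := [set copy_edge x j | j : J].

Lemma copy_edge_inj x x' j j' : copy_edge x j = copy_edge x' j' -> j = j' /\ x j = x' j.
Proof.
move=> /setP E; have := E (emb (j, x j)); have := E (emb (succ j, x (succ j))).
rewrite !inE !eqxx orbT /= => /esym/orP sj' /esym/orP[] /eqP/emb_inj[jj' xj].
  by rewrite xj jj'.
case: sj' => /eqP/emb_inj[sjj' _].
  by have := succ2_neq j'; rewrite -jj' sjj' eqxx.
by have := succ_neq j; rewrite sjj' -jj' eqxx.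
Qed.

Lemma cards2_copy_edge x j : #|copy_edge x j| = 2%N.
Proof.
rewrite cards2; case: eqP => // /emb_inj[E _].
by have := succ_neq j; rewrite -E eqxx.
Qed.

Lemma card_copy_vertices x : #|copy_vertices x| = #|J|.
Proof. by rewrite card_imset // => j j' /emb_inj[]. Qed.

Lemma card_copy_edges x : #|copy_edges x| = #|J|.
Proof. by rewrite card_imset // => j j' /copy_edge_inj[]. Qed.

Lemma copy_edges_sub x e : e \in copy_edges x -> e \subset copy_vertices x.
Proof.
case/imsetP => j _ ->; apply/fintype.subsetP => v.
by rewrite !inE => /orP[]/eqP->; apply: imset_f.
Qed.

Lemma card_copy_edgesU x x' :
  (\sum_j (if x j == x' j then 1 else 2) <= #|copy_edges x :|: copy_edges x'|)%N.
Proof.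
have shared : (#|copy_edges x :&: copy_edges x'| <= \sum_j (x j == x' j))%N.
  have -> : (\sum_j (x j == x' j) = #|[set j | x j == x' j]|)%N.
    by rewrite -sum1dep_card [RHS]big_mkcond; apply: eq_bigr => j _; case: eqP.
  apply: leq_trans (leq_imset_card (copy_edge x) _).
  apply/subset_leq_card/fintype.subsetP => e.
  rewrite inE => /andP[/imsetP[j _ ->] /imsetP[j' _ /copy_edge_inj[_ xj]]].
  by rewrite imset_f // inE xj.
rewrite -(leq_add2r (\sum_j (x j == x' j))) -big_split (eq_bigr (fun=> 2%N)) => [|j _].
  rewrite sum_nat_const muln2 -addnn; apply: leq_trans (leq_add (leqnn _) shared).
  by rewrite cardsUI !card_copy_edges.
by case: eqP.
Qed.

Section SecondMoment.
Context {R : realFieldType} {S : finType}.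
Variables (mu : {set V} -> S -> R) (target : {set V} -> S) (q : R).
Hypothesis mu_ge0 : forall e y, 0 <= mu e y.
Hypothesis mu_sum : forall e, \sum_y mu e y = 1.
Hypothesis mu_target : forall x e, e \in copy_edges x -> mu e (target e) = q.
Hypothesis q01 : 0 < q <= 1.
Local Notation k := #|J|.
Local Notation m := (#|T|%:R : R).

Definition copy_at x : pred {ffun {set V} -> S} := agree_on (copy_edges x) target.

Lemma weight_copy_at x : weight mu (copy_at x) = q ^+ k.
Proof.
rewrite weight_agree_on // (eq_bigr (fun=> q)) => [|e /mu_target //].
by rewrite prodr_const card_copy_edges.
Qed.

Lemma weight_copy_atI x x' :
  weight mu (fun s => copy_at x s && copy_at x' s) <=
  \prod_j (if x j == x' j then q else q ^+ 2).
Proof.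
have [q0 q1] := andP q01.
have -> : weight mu (fun s => copy_at x s && copy_at x' s) =
    weight mu (agree_on (copy_edges x :|: copy_edges x') target).
  by apply: eq_expect => s; rewrite agree_onU.
rewrite weight_agree_on // (eq_bigr (fun=> q)) => [|e]; last first.
  by rewrite inE => /orP[] /mu_target.
rewrite prodr_const [leRHS](eq_bigr (fun j => q ^+ (if x j == x' j then 1 else 2))).
  by rewrite prodrXr ler_wiXn2l ?(ltW q0) // card_copy_edgesU.
by move=> j _; case: ifP; rewrite ?expr1.
Qed.

Lemma expect_copy_count_sqr_le :
  expect mu (fun s => (\sum_x (copy_at x s)%:R) ^+ 2) <=
  (m * q * (1 + m * q)) ^+ k.
Proof.
have [q0 q1] := andP q01.
have -> : expect mu (fun s => (\sum_x (copy_at x s)%:R) ^+ 2) =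
    \sum_x \sum_x' weight mu (fun s => copy_at x s && copy_at x' s).
  under eq_bigr => x _ do rewrite -expect_sum.
  rewrite -expect_sum; apply: eq_expect => s; rewrite expr2 big_distrlr /=.
  by apply: eq_bigr => x _; apply: eq_bigr => x' _; rewrite -natrM mulnb.
apply: le_trans (_ : _ <= \sum_(x : {ffun J -> T}) \sum_(x' : {ffun J -> T})
    \prod_j (if x j == x' j then q else q ^+ 2)) _.
  by apply: ler_sum => x _; apply: ler_sum => x' _; apply: weight_copy_atI.
rewrite (sum_ffun2_prod (fun y y' => if y == y' then q else q ^+ 2)).
have y_sum (y : T) : \sum_y' (if y == y' then q else q ^+ 2) <= q + m * q ^+ 2.
  rewrite (bigD1 y) //= eqxx lerD2l.
  rewrite (eq_bigr (fun=> q ^+ 2)) => [|y']; last by rewrite eq_sym => /negbTE ->.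
  rewrite sumr_const -[leLHS]mulr_natl ler_wpM2r ?sqr_ge0 // ler_nat.
  exact: max_card.
have y_sum_ge0 (y : T) : 0 <= \sum_y' (if y == y' then q else q ^+ 2).
  by apply: sumr_ge0 => y' _; case: ifP; rewrite ?sqr_ge0 ?ltW.
rewrite lerXn2r ?nnegrE ?sumr_ge0 //; first by rewrite !mulr_ge0 ?addr_ge0 ?mulr_ge0 // ltW.
apply: le_trans (ler_sum _ (fun y _ => y_sum y)) _.
by rewrite sumr_const -[leLHS]mulr_natl; lra.
Qed.

Section GoodCopies.
Variables (cs_in cs_out : seq S) (h : R).
Hypothesis mu_out :
  forall e c, #|e| = 2%N -> c \in cs_in ++ cs_out -> h <= mu e c.
Hypothesis h01 : 0 <= h <= 1.
Hypotheses (uniq_in : uniq cs_in) (uniq_out : uniq cs_out).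
Hypothesis size_cs : size cs_in = size cs_out.
Hypothesis card_J_gt1 : (1 < #|J|)%N.
Local Notation n := #|V|.
Local Notation eta := (n%:R * (decay n h ^+ size cs_out * potential n k)).

Definition good_copy x : pred {ffun {set V} -> S} := fun s =>
  [&& copy_at x s, grow s cs_in (copy_vertices x) == [set: V] &
      grow s cs_out (copy_vertices x) == [set: V]].

Lemma weight_copy_at_grow_neqT x cs :
  uniq cs -> {subset cs <= cs_in ++ cs_out} -> size cs = size cs_out ->
  weight mu (fun s => copy_at x s && (grow s cs (copy_vertices x) != [set: V])) <=
  eta * q ^+ k.
Proof.
move=> ucs scs <-; rewrite -(weight_copy_at x) -weight_restrict.
rewrite (_ : weight mu (copy_at x) = weight (restrict_weight mu
    (fun e y => (e \in copy_edges x) ==> (y == target e))) predT); last first.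
  by rewrite weight_restrict; apply: eq_expect => s; rewrite andbT.
rewrite -(card_copy_vertices x); apply: weight_grow_neqT => //.
- by move=> e y; rewrite mulr_ge0.
- by rewrite card_copy_vertices.
move=> e c e2 ex /scs ccs; have {}ex : e \notin copy_edges x.
  exact: contra (@copy_edges_sub x e) ex.
rewrite /share_ge /restrict_weight (negbTE ex) mulr1.
under eq_bigr do rewrite mulr1.
by rewrite mu_sum mulr1 mu_out.
Qed.

Lemma weight_good_copy x : q ^+ k * (1 - 2 * eta) <= weight mu (good_copy x).
Proof.
have fail_in : weight mu (fun s => copy_at x s &&
    (grow s cs_in (copy_vertices x) != [set: V])) <= eta * q ^+ k.
  by apply: weight_copy_at_grow_neqT => // c; rewrite mem_cat => ->.
have fail_out : weight mu (fun s => copy_at x s &&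
    (grow s cs_out (copy_vertices x) != [set: V])) <= eta * q ^+ k.
  by apply: weight_copy_at_grow_neqT => // c; rewrite mem_cat orbC => ->.
suff : q ^+ k <= weight mu (good_copy x) + (eta * q ^+ k + eta * q ^+ k) by lra.
apply: le_trans (lerD (lexx _) (lerD fail_in fail_out)).
rewrite -(weight_copy_at x) -!expectD; apply: ler_expect => // s.
rewrite -!natrD ler_nat /good_copy.
by case: copy_at; case: (_ == _); case: (_ == _).
Qed.

Lemma weight_exists_good_copy : (0 < #|T|)%N ->
  2 * (1 - 2 * eta) - (1 + (m * q)^-1) ^+ k <=
  weight mu (fun s => [exists x, good_copy x s]).
Proof.
move=> T0; have [q0 q1] := andP q01; have mq0 : 0 < m * q by rewrite mulr_gt0 ?ltr0n.
pose Z s : R := \sum_x (good_copy x s)%:R.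
pose X s : R := \sum_x (copy_at x s)%:R.
have ZX s : 0 <= Z s <= X s.
  rewrite sumr_ge0 //=; apply: ler_sum => x _; rewrite ler_nat /good_copy.
  by case: copy_at => //=; case: (_ && _).
pose l := (m * q) ^+ k; have l0 : 0 < l by rewrite exprn_gt0.
have EZ : l * (1 - 2 * eta) <= expect mu Z.
  rewrite expect_sum.
  apply: le_trans (_ : \sum_(x : {ffun J -> T}) q ^+ k * (1 - 2 * eta) <= _).
    by rewrite sumr_const card_ffun -[leRHS]mulr_natl natrX /l exprMn -mulrA.
  by apply: ler_sum => x _; apply: weight_good_copy.
have EX : expect mu (fun s => X s ^+ 2) <= l * (1 + m * q) ^+ k.
  by rewrite -exprMn; apply: expect_copy_count_sqr_le.
apply: le_trans (le_trans (weight_neq0_ge mu_ge0 l0 ZX) _); last first.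
  apply: ler_expect => // s; rewrite ler_nat.
  case: existsP => [_|none]; first exact: leq_b1.
  rewrite /Z big1 ?eqxx // => x _.
  by case: (boolP (good_copy x s)) => // good; case: none; exists x.
apply: lerB.
  have -> : 2 * (1 - 2 * eta) = 2 / l * (l * (1 - 2 * eta)) by field; rewrite gt_eqF.
  by rewrite ler_wpM2l // divr_ge0 // ltW.
have -> : (1 + (m * q)^-1) ^+ k = l ^- 2 * (l * (1 + m * q) ^+ k).
  have -> : 1 + (m * q)^-1 = (1 + m * q) / (m * q) by field; rewrite !gt_eqF ?ltr0n.
  by rewrite expr_div_n -/l; field; rewrite gt_eqF.
by rewrite ler_wpM2l // invr_ge0 sqr_ge0.
Qed.

End GoodCopies.
End SecondMoment.
End PatternCopies.

(** * Spanners from grown sets *)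

Section Steps.
Context {V : finType}.
Implicit Types (u v : V) (p : seq V).

Definition steps u p : seq {set V} := pairmap (fun x y => [set x; y]) u p.

Lemma steps_cat u p1 p2 : steps u (p1 ++ p2) = steps u p1 ++ steps (last u p1) p2.
Proof. exact: pairmap_cat. Qed.

Lemma last_rev_belast u p : last (last u p) (rev (belast u p)) = u.
Proof. by rewrite -(last_cons u) -rev_rcons -lastI rev_cons last_rcons. Qed.

Lemma steps_rev u p : steps (last u p) (rev (belast u p)) = rev (steps u p).
Proof.
elim: p u => //= x p IH u; rewrite !rev_cons -cats1 steps_cat IH -cats1.
by rewrite last_rev_belast /= finset.setUC.
Qed.

Lemma simple_steps u p : exists p',
  [/\ last u p' = last u p, uniq (u :: p') & subseq (steps u p') (steps u p)].
Proof.
elim: p u => [|x p IH] u; first by exists [::].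
have [p' [lp' up' sp']] := IH x; have [up|] := boolP (u \in x :: p'); last first.
  by exists (x :: p'); rewrite /= lp' eqxx sp'; split=> //; apply/andP.
have [p2 [lp2 up2 sp2]] : exists p2, [/\ last u p2 = last x p', uniq (u :: p2) &
    subseq (steps u p2) (steps x p')].
  move: up; rewrite inE => /predU1P[->|/splitPr up]; first by exists p'.
  case: up lp' up' sp' => p1 p2 _ up' _; exists p2; split; first by rewrite last_cat.
    by move: up'; rewrite cons_uniq cat_uniq => /and4P[].
  rewrite steps_cat; apply: subseq_trans (suffix_subseq _ _); exact: subseq_cons.
exists p2; split; rewrite ?lp2 //.
exact: subseq_trans sp2 (subseq_trans sp' (subseq_cons _ _)).
Qed.

End Steps.

Section Chain.
Context {V S : finType}.
Implicit Types (F : {set {set V}}) (s : {set V} -> S) (cs : seq S) (u v : V).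

Definition chain F s cs u v : Prop :=
  exists p, [/\ all [in F] (steps u p), last u p = v & subseq (map s (steps u p)) cs].

Lemma chain_refl F s cs u : chain F s cs u u.
Proof. by exists [::]; split=> //=; exact: sub0seq. Qed.

Lemma chain_edge F s u v : [set u; v] \in F -> chain F s [:: s [set u; v]] u v.
Proof. by move=> uvF; exists [:: v]; rewrite /= uvF eqxx. Qed.

Lemma chain_sub F F' s cs u v : F \subset F' -> chain F s cs u v -> chain F' s cs u v.
Proof.
by move=> /fintype.subsetP FF' [p [pF lp sp]]; exists p; split=> //; apply: sub_all pF.
Qed.

Lemma chain_cat F s cs1 cs2 u v w :
  chain F s cs1 u v -> chain F s cs2 v w -> chain F s (cs1 ++ cs2) u w.
Proof.
move=> [p1 [p1F lp1 sp1]] [p2 [p2F lp2 sp2]]; exists (p1 ++ p2).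
by rewrite steps_cat last_cat lp1 map_cat all_cat p1F p2F cat_subseq.
Qed.

Lemma chain_rev F s cs u v : chain F s cs u v -> chain F s (rev cs) v u.
Proof.
move=> [p [pF <- sp]]; exists (rev (belast u p)).
by rewrite steps_rev all_rev last_rev_belast map_rev subseq_rev.
Qed.

Lemma grow_step_forest (s : {ffun {set V} -> S}) (U : {set V}) c : exists F,
  [/\ (#|F| + #|U|)%N = #|grow_step s U c|, {in F, forall e, s e = c} &
      {in grow_step s U c, forall v, exists2 u, u \in U & chain F s [:: c] u v}].
Proof.
set U' := grow_step s U c.
pose parent v := odflt v [pick u in U | s [set u; v] == c].
have parentP v : v \in U' :\: U -> parent v \in U /\ s [set parent v; v] = c.
  rewrite !inE => /andP[vU]; rewrite (negbTE vU) /= => /existsP[u uP].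
  by rewrite /parent; case: pickP => [w /andP[wU /eqP swv] //|/(_ u)]; rewrite uP.
exists [set [set parent v; v] | v in U' :\: U]; split.
- rewrite card_in_imset => [|v w vU wU /setP/(_ v)].
    by rewrite -(cardsID U U') (finset.setIidPr (sub_grow_step s U c)) addnC.
  have [pU _] := parentP w wU; rewrite !inE eqxx orbT => /esym/orP[]/eqP // vE.
  by move: vU; rewrite vE inE pU.
- by move=> e /imsetP[v /parentP[_ sc] ->].
- move=> v vU'; have [vU|vU] := boolP (v \in U); first by exists v => //; exact: chain_refl.
  have vD : v \in U' :\: U by rewrite inE vU vU'.
  have [pU <-] := parentP v vD; exists (parent v) => //.
  by apply: chain_edge; apply: imset_f.
Qed.

Lemma cardsU_states (I : finType) (s : I -> S) (F1 F2 : {set I}) cs1 cs2 :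
  {in F1, forall e, s e \in cs1} -> {in F2, forall e, s e \in cs2} -> uniq (cs1 ++ cs2) ->
  #|F1 :|: F2| = (#|F1| + #|F2|)%N.
Proof.
rewrite cat_uniq => s1 s2 /and3P[_ /hasPn cs12 _].
rewrite cardsU (_ : F1 :&: F2 = finset.set0) ?cards0 ?subn0 //.
by apply/setP => e; rewrite !inE; apply/negP => /andP[/s1 e1 /s2/cs12/negP[]].
Qed.

Lemma grow_forest (s : {ffun {set V} -> S}) cs (U : {set V}) : uniq cs -> exists F,
  [/\ (#|F| + #|U|)%N = #|grow s cs U|, {in F, forall e, s e \in cs} &
      {in grow s cs U, forall v, exists2 u, u \in U & chain F s cs u v}].
Proof.
elim: cs U => [|c cs IH] U /=.
  move=> _; exists finset.set0; split=> [|e|v vU]; rewrite ?cards0 ?inE //.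
  by exists v => //; exact: chain_refl.
move=> ucs; have /andP[_ /(IH (grow_step s U c))[F1 [cF1 sF1 chF1]]] := ucs.
have [F0 [cF0 sF0 chF0]] := grow_step_forest s U c.
exists (F0 :|: F1); split.
- have sF0' : {in F0, forall e, s e \in [:: c]} by move=> e /sF0 ->; rewrite mem_head.
  by rewrite (cardsU_states sF0' sF1 ucs) -cF1 -cF0; lia.
- by move=> e; rewrite !inE => /orP[/sF0 ->|/sF1 ->]; rewrite ?eqxx ?orbT.
- move=> v /chF1[w /chF0[u uU chu] chw]; exists u => //.
  rewrite -cat1s; apply: (@chain_cat _ _ _ _ _ w).
    exact: chain_sub (finset.subsetUl _ _) chu.
  exact: chain_sub (finset.subsetUr _ _) chw.
Qed.

End Chain.

Section OptimalSpanner.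
Context {V : finType} {R : realType}.
Implicit Types (G : tgraph V R) (F : {set {set V}}) (u v : V) (p : seq V).

Definition increasing_path F (l : {set V} -> R) u v p : Prop :=
  [/\ all [in F] (steps u p), last u p = v, uniq (u :: p) &
      sorted <=%R (map l (steps u p))].

Lemma temporal_pathE G u v p :
  temporal_path G u v p <-> increasing_path (edges G) (label G) u v p.
Proof.
rewrite /temporal_path /increasing_path.
have -> : path (adj G) u p = all [in edges G] (steps u p).
  by elim: p u => //= x p IH u; rewrite IH.
have -> // : pairmap (fun x y => label G [set x; y]) u p = map (label G) (steps u p).
by elim: p u => //= x p IH u; rewrite IH.
Qed.

Lemma has_optimal_spannerP G :
  has_optimal_spanner G <->
  exists F, [/\ F \subset edges G, #|F| = (2 * #|V| - 4)%N &
    forall u v, u != v -> exists p, increasing_path F (label G) u v p].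
Proof.
split=> [[H [HG lH cH] cardH]|[F [FG cardF cF]]].
  exists (edges H); split=> // u v /cH[p /temporal_pathE[pH lp up sp]].
  exists p; split=> //; have <- // : map (label H) (steps u p) = map (label G) (steps u p).
  by apply/eq_in_map => e /(allP pH)/lH.
have F2 e : e \in F -> #|e| = 2%N by move/(fintype.subsetP FG); exact: edges_card2.
exists (TGraph (SGraph F2) (label G)) => //; split=> //= u v /cF[p pP].
by exists p; apply/temporal_pathE.
Qed.

Lemma eq_order_optimal_spanner G G' : edges G = edges G' ->
  {in edges G &, forall e e', label G e <= label G e' -> label G' e <= label G' e'} ->
  has_optimal_spanner G -> has_optimal_spanner G'.
Proof.
move=> eG lG /has_optimal_spannerP[F [FG cardF cF]]; apply/has_optimal_spannerP.
exists F; rewrite -eG; split=> // u v /cF[p [pF lp up sp]]; exists p; split=> //.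
move: sp; rewrite !sorted_map; apply: sub_in_sorted pF => e e' /(fintype.subsetP FG) eG'.
by move=> /(fintype.subsetP FG); exact: lG.
Qed.

Lemma chains_optimal_spanner (S : finType) (before : rel S) (s : {set V} -> S) (cs : seq S)
    G F :
  pairwise before cs -> F \subset edges G -> #|F| = (2 * #|V| - 4)%N ->
  {in F &, forall e e', before (s e) (s e') -> label G e <= label G e'} ->
  (forall u v, chain F s cs u v) -> has_optimal_spanner G.
Proof.
move=> cs_before FG cardF lF chF; apply/has_optimal_spannerP; exists F; split=> // u v _.
have [p [pF lp sp]] := chF u v; have [p' [lp' up' sp']] := simple_steps u p.
have p'F : all [in F] (steps u p') by apply/allP => e /(mem_subseq sp')/(allP pF).
exists p'; split; rewrite ?lp' // sorted_map; apply: sub_in_sorted lF _ p'F _.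
rewrite -sorted_map; apply/pairwise_sorted/subseq_pairwise/cs_before.
exact: subseq_trans (map_subseq _ sp') sp.
Qed.

End OptimalSpanner.

(* The square on [bool * bool], oriented so that the edges from the diagonal
   change the first coordinate and the others change the second one. *)
Definition square_succ (j : bool * bool) : bool * bool :=
  if j.1 == j.2 then (~~ j.1, j.2) else (j.1, ~~ j.2).

Lemma square_succ_neq j : square_succ j != j.
Proof. by case: j => [[] []]. Qed.

Lemma square_succ2_neq j : square_succ (square_succ j) != j.
Proof. by case: j => [[] []]. Qed.

Section Square.
Context {V S T : finType} (emb : (bool * bool) * T -> V).
Hypothesis emb_inj : injective emb.
Variables (A B : S) (cs_in cs_out : seq S).
Implicit Types (x : {ffun bool * bool -> T}) (s : {ffun {set V} -> S}).

Local Notation square_edge := (copy_edge square_succ emb).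
Local Notation square_edges := (copy_edges square_succ emb).
Local Notation schedule := (rev cs_in ++ [:: A, B & cs_out]).

Definition square_state (e : {set V}) : S :=
  if [exists x, exists j, (j.1 == j.2) && (e == square_edge x j)] then A else B.

Lemma square_stateE x j :
  square_state (square_edge x j) = if j.1 == j.2 then A else B.
Proof.
rewrite /square_state; case: existsP => [[x' /existsP[j' /andP[dj' /eqP]]]|nodiag].
  by case/(copy_edge_inj square_succ_neq square_succ2_neq emb_inj) => -> _; rewrite dj'.
by case: eqP => // dj; case: nodiag; exists x; apply/existsP; exists j; rewrite dj !eqxx.
Qed.

Lemma square_chain s x (F : {set {set V}}) : square_edges x \subset F ->
  copy_at square_succ emb square_state x s ->
  {in copy_vertices emb x &, forall u v, chain F s [:: A; B] u v}.
Proof.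
move=> /fintype.subsetP xF /forallP sx.
pose w j := emb (j, x j).
have edge j : square_edge x j \in F /\ s (square_edge x j) = if j.1 == j.2 then A else B.
  have jx : square_edge x j \in square_edges x by exact: imset_f.
  split; first exact: xF.
  by have := sx (square_edge x j); rewrite jx square_stateE => /eqP.
have chA a a' b : chain F s [:: A] (w (a, b)) (w (a', b)).
  have [->|aa'] := eqVneq a a'; first exact: chain_refl.
  have [eF eA] := edge (b, b); rewrite eqxx in eA.
  have eE : square_edge x (b, b) = [set w (a, b); w (a', b)].
    by case: a a' b aa' {eF eA} => [] [] [] //= _; rewrite finset.setUC.
  by rewrite -eA eE; apply: chain_edge; rewrite -eE.
have chB a b b' : chain F s [:: B] (w (a, b)) (w (a, b')).
  have [->|bb'] := eqVneq b b'; first exact: chain_refl.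
  have [eF eB] := edge (a, ~~ a); rewrite (_ : (_ == _) = false) in eB; last by case: (a).
  have eE : square_edge x (a, ~~ a) = [set w (a, b); w (a, b')].
    by case: a b b' bb' {eF eB} => [] [] [] //= _; rewrite finset.setUC.
  by rewrite -eB eE; apply: chain_edge; rewrite -eE.
move=> u v /imsetP[[a b] _ ->] /imsetP[[a' b'] _ ->].
exact: chain_cat (chA a a' b) (chB a' b b').
Qed.

Lemma good_square_chains s x : uniq schedule ->
  good_copy square_succ emb square_state cs_in cs_out x s ->
  exists F : {set {set V}}, [/\ #|F| = (2 * #|V| - 4)%N,
    {in F, forall e, s e \in schedule} & forall u v, chain F s schedule u v].
Proof.
set E := square_edges x; set C := copy_vertices emb x.
move=> uschedule /and3P[sE /eqP Cin /eqP Cout].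
have := uschedule; rewrite cat_uniq rev_uniq => /and3P[uin _ umid].
have uout : uniq cs_out by case/and3P: umid.
have [F1 [cF1 sF1 ch1]] := grow_forest s C uin.
have [F2 [cF2 sF2 ch2]] := grow_forest s C uout.
have {}sF1 : {in F1, forall e, s e \in rev cs_in} by move=> e /sF1; rewrite mem_rev.
have sEAB : {in E, forall e, s e \in [:: A; B]}.
  move=> e eE; have := forallP sE e; rewrite eE => /eqP ->.
  by rewrite !inE /square_state; case: ifP; rewrite eqxx ?orbT.
have sEF2 : {in E :|: F2, forall e, s e \in [:: A, B & cs_out]}.
  move=> e; rewrite inE -[[:: A, B & _]]/([:: A; B] ++ cs_out) mem_cat.
  by case/orP => [/sEAB ->|/sF2 ->]; rewrite ?orbT.
exists (F1 :|: (E :|: F2)); split.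
- rewrite (cardsU_states sF1 sEF2 uschedule) (cardsU_states sEAB sF2 umid).
  rewrite (card_copy_edges square_succ_neq square_succ2_neq emb_inj).
  move: cF1 cF2; rewrite Cin Cout cardsT (card_copy_vertices emb_inj).
  by rewrite card_prod card_bool; lia.
- by move=> e; rewrite inE mem_cat => /orP[/sF1 ->|/sEF2 ->]; rewrite ?orbT.
move=> u v; rewrite -[[:: A, B & _]]/([:: A; B] ++ cs_out).
have [u' u'C ch_in] : exists2 u', u' \in C & chain F1 s cs_in u' u.
  by apply: ch1; rewrite Cin inE.
have [v' v'C ch_out] : exists2 v', v' \in C & chain F2 s cs_out v' v.
  by apply: ch2; rewrite Cout inE.
have F1F : F1 \subset F1 :|: (E :|: F2) by exact: finset.subsetUl.
have F2F : F2 \subset F1 :|: (E :|: F2) by rewrite finset.setUA finset.subsetUr.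
have EF : E \subset F1 :|: (E :|: F2) by rewrite finset.setUCA finset.subsetUl.
apply: chain_cat (chain_rev (chain_sub F1F ch_in)) _.
apply: chain_cat (square_chain EF sE u'C v'C) _.
exact: chain_sub F2F ch_out.
Qed.

End Square.

Local Open Scope classical_set_scope.

(** * Discretisation of the random temporal graph *)

Section FiniteFibers.
Context d (T : measurableType d) (R : realType) (mu : {measure set T -> \bar R}).
Context (I : finType) (X : T -> I).
Hypothesis mX : forall i, measurable [set w | X w = i].

Lemma measurable_finite_preimage (A : set I) : measurable [set w | A (X w)].
Proof.
have -> : [set w | A (X w)] = \bigcup_(i in A) [set w | X w = i].
  apply/seteqP; split=> [w Aw|w [i Ai /= E]]; first by exists (X w).
  by rewrite /= E.
by apply: fin_bigcup_measurable => //; exact: finite_finset.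
Qed.

Lemma measure_finite_fibers (A : set T) : measurable A ->
  mu A = (\sum_i mu (A `&` [set w | X w = i]))%E.
Proof.
move=> mA; rewrite /index_enum -[Finite.enum _]enumT fsbig_seq ?enum_uniq //.
rewrite -measure_fin_bigcup //=.
- congr (mu _); apply/seteqP; split=> [w Aw|w [i _ []]] //.
  by exists (X w) => //=; rewrite mem_enum.
- by move=> i j _ _ [w [[_ <-] [_ <-]]].
- by move=> i _; apply: measurableI.
Qed.

End FiniteFibers.

Lemma gnp_pmf_prodE (R : realType) (n : nat) (p : R) (g : sgraph 'I_n) :
  gnp_pmf p g = \prod_(e : {set 'I_n})
    (if e \in edges g then p else if #|e| == 2%N then 1 - p else 1).
Proof.
pose pairs := [set e : {set 'I_n} | #|e| == 2%N]%SET.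
have edges2 : edges g \subset pairs.
  by apply/fintype.subsetP => e /(@edges_card2 _ g); rewrite inE => ->.
rewrite (bigID [in edges g]) /= (eq_bigr (fun=> p)) => [|e ->//].
rewrite prodr_const; congr (_ * _).
rewrite (eq_bigr (fun e : {set 'I_n} => if #|e| == 2%N then 1 - p else 1)); last first.
  by move=> e /negbTE ->.
rewrite -big_mkcondr prodr_const; congr (_ ^+ _).
have -> : 'C(n, 2) = #|pairs| by rewrite card_draws card_ord.
rewrite -(cardsID (edges g) pairs) (finset.setIidPr edges2) addKn; apply: eq_card => e.
by rewrite !inE.
Qed.

Section RandomTemporalGraph.
Context d (T : measurableType d) (R : realType) (P : probability T R).
Variables (n : nat) (p : R) (G : T -> tgraph 'I_n R).
Hypothesis FG : is_Fnp P p G.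
Implicit Types (w : T) (e : {set 'I_n}) (g : {set {set 'I_n}}).

Lemma measurable_edges g : measurable [set w | edges (G w) = g].
Proof.
have [/forall_inP g2|/forallPn[e]] := boolP [forall e in g, #|e| == 2%N].
  exact: (Fnp_measurable_graph FG (SGraph (fun e eg => eqP (g2 e eg)))).
rewrite negb_imply => /andP[eg e2].
rewrite (_ : [set w | _] = set0) //; apply/seteqP; split=> // w /= E.
by case/eqP: e2; apply: (@edges_card2 _ (G w)); rewrite E.
Qed.

Lemma measurable_mem_edges e : measurable [set w | e \in edges (G w)].
Proof. exact: (measurable_finite_preimage measurable_edges (fun g => e \in g)). Qed.

Definition label_le w : {set {set 'I_n} * {set 'I_n}} :=
  [set ee | [&& ee.1 \in edges (G w), ee.2 \in edges (G w) &
                label (G w) ee.1 <= label (G w) ee.2]]%SET.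

Lemma measurable_mem_label_le ee : measurable [set w | ee \in label_le w].
Proof.
case: ee => e e'; have -> : [set w | (e, e') \in label_le w] =
    ([set w | e \in edges (G w)] `&` [set w | e' \in edges (G w)]) `&`
    [set w | label (G w) e <= label (G w) e'].
  by apply/seteqP; split=> w /=; rewrite inE /=; [case/and3P|case=> -[-> ->] ->].
have mlabel e1 := Fnp_measurable_label FG (e := e1).
apply: measurable_fun_le.
- by apply: measurableI; exact: measurable_mem_edges.
- exact: (measurable_funS (measurable_mem_edges e) (@subIsetl _ _ _) (mlabel e)).
- exact: (measurable_funS (measurable_mem_edges e') (@subIsetr _ _ _) (mlabel e')).
Qed.

Lemma measurable_label_le r : measurable [set w | label_le w = r].
Proof.
have -> : [set w | label_le w = r] =
    \bigcap_(ee in setT) [set w | (ee \in label_le w) = (ee \in r)].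
  apply/seteqP; split=> w /= rE; first by move=> ee _ /=; rewrite rE.
  by apply/setP => ee; apply: rE.
apply: fin_bigcap_measurable => [|ee _]; first exact: finite_finset.
case: (ee \in r); first exact: measurable_mem_label_le.
rewrite (_ : [set w | _] = ~` [set w | ee \in label_le w]).
  exact/measurableC/measurable_mem_label_le.
by apply/seteqP; split=> w /=; [move=> ->|move/negP/negbTE].
Qed.

(* Whether a spanner exists depends on finitely many comparisons of labels. *)
Lemma measurable_has_optimal_spanner : measurable [set w | has_optimal_spanner (G w)].
Proof.
pose order_type w := (edges (G w), label_le w).
have morder c : measurable [set w | order_type w = c].
  case: c => g r; have -> : [set w | order_type w = (g, r)] =
      [set w | edges (G w) = g] `&` [set w | label_le w = r].
    by rewrite /order_type; apply/seteqP; split=> w /= [-> ->].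
  by apply: measurableI; [exact: measurable_edges|exact: measurable_label_le].
have -> : [set w | has_optimal_spanner (G w)] =
    [set w | (order_type @` [set w | has_optimal_spanner (G w)]) (order_type w)].
  apply/seteqP; split=> [w hw|w [w' hw' [eE rE]]]; first by exists w.
  apply: eq_order_optimal_spanner eE _ hw' => e e' eG e'G le_ee'.
  have : (e, e') \in label_le w' by rewrite inE eG e'G.
  by rewrite rE inE => /and3P[].
exact: (measurable_finite_preimage morder).
Qed.

Section State.
Context {C : finType} (kappa : R -> option C).
Hypothesis mkappa : forall y, measurable [set t | kappa t = y].
Implicit Types (f : {ffun {set 'I_n} -> option C}) (y : option C).

(* [None] stands both for a non-edge and for a label outside all cells. *)
Definition state w : {ffun {set 'I_n} -> option C} :=
  [ffun e => if e \in edges (G w) then kappa (label (G w) e) else None].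

Definition cell_prob y : R := fine (uniform_prob (@ltr01 R) [set t | kappa t = y]).

Definition state_law e y : R :=
  if #|e| == 2%N then p * cell_prob y + (1 - p) * (y == None)%:R
  else (y == None)%:R.

Lemma cell_probE y : (cell_prob y)%:E = uniform_prob (@ltr01 R) [set t | kappa t = y].
Proof. by rewrite /cell_prob fineK //; apply: fin_num_measure; exact: mkappa. Qed.

Lemma sum_cell_prob : \sum_y cell_prob y = 1.
Proof.
apply: EFin_inj; rewrite -sumEFin -(probability_setT (uniform_prob (@ltr01 R))).
rewrite (measure_finite_fibers (uniform_prob (@ltr01 R)) mkappa measurableT).
by apply: eq_bigr => y _; rewrite setTI cell_probE.
Qed.

Lemma state_law_ge0 e y : 0 <= p <= 1 -> 0 <= state_law e y.
Proof.
case/andP => p0 p1; rewrite /state_law; case: ifP => // _.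
by rewrite addr_ge0 // mulr_ge0 ?subr_ge0 // fine_ge0.
Qed.

Lemma sum_state_law e : \sum_y state_law e y = 1.
Proof.
have sumN : \sum_y (y == None :> option C)%:R = 1 :> R.
  by rewrite (bigD1 None) //= big1 ?addr0 // => y /negbTE ->.
rewrite /state_law; case: (#|e| == 2%N); last exact: sumN.
by rewrite big_split /= -!mulr_sumr sum_cell_prob sumN; ring.
Qed.

Lemma measurable_state f : measurable [set w | state w = f].
Proof.
have -> : [set w | state w = f] = \bigcap_(e in setT) [set w | state w e = f e].
  apply/seteqP; split=> w /= sf; first by move=> e _ /=; rewrite sf.
  by apply/ffunP => e; apply: sf.
apply: fin_bigcap_measurable => [|e _]; first exact: finite_finset.
pose K := [set w | e \in edges (G w)] `&`
  (fun w => label (G w) e) @^-1` [set t | kappa t = f e].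
have mK : measurable K.
  exact: (Fnp_measurable_label FG (measurable_mem_edges e) (mkappa (f e))).
have [fN|fN] := eqVneq (f e) None.
  rewrite (_ : [set w | _] = K `|` ~` [set w | e \in edges (G w)]).
    by apply: measurableU => //; apply/measurableC/measurable_mem_edges.
  apply/seteqP; split=> w /=; rewrite ffunE; case: ifPn => eG.
  - by left.
  - by right.
  - by case=> [[]|].
  - by rewrite fN.
rewrite (_ : [set w | _] = K) //.
apply/seteqP; split=> w /=; rewrite ffunE; case: ifPn => eG.
- by [].
- by move=> E; rewrite -E in fN.
- by case.
- by case=> /negPn; rewrite eG.
Qed.

Lemma prob_edges_state g f :
  P [set w | edges (G w) = g /\ state w = f] =
  (\prod_e (if e \in g then (if #|e| == 2%N then p * cell_prob (f e) else 0)
            else (if #|e| == 2%N then 1 - p else 1) * (f e == None)%:R))%:E.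
Proof.
have [/forallP compat|/forallPn[e incompat]] :=
  boolP [forall e, if e \in g then #|e| == 2%N else f e == None]; last first.
  rewrite [RHS](_ : _ = 0%E); last first.
    rewrite (bigD1 e) //=; move: incompat.
    by case: ifP => _ /negbTE ->; rewrite ?mulr0 mul0r.
  rewrite (_ : [set w | _] = set0) ?measure0 //; apply/seteqP; split=> // w /= [eg sf].
  move: incompat; rewrite -eg -sf ffunE; case: (boolP (e \in edges (G w))) => [|//].
  by move/(@edges_card2 _ (G w)) ->.
have g2 e : e \in g -> #|e| = 2%N by move=> eg; have := compat e; rewrite eg => /eqP.
have gN e : e \notin g -> f e = None.
  by move=> /negbTE eg; have := compat e; rewrite eg => /eqP.
have -> : [set w | edges (G w) = g /\ state w = f] = [set w | edges (G w) = g /\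
    forall e, e \in g -> [set t | kappa t = f e] (label (G w) e)].
  apply/seteqP; split=> w [eg]; first by move=> <-; split=> // e; rewrite /= ffunE eg => ->.
  by move=> lab; split=> //; apply/ffunP => e; rewrite ffunE eg; case: ifPn => [/lab|/gN].
rewrite (Fnp_label FG (SGraph g2) (B := fun e => [set t | kappa t = f e])) //.
rewrite (Fnp_graph FG (SGraph g2)) gnp_pmf_prodE /=.
under [X in (_ * X)%E]eq_bigr do rewrite -cell_probE.
rewrite prodEFin -EFinM [X in _ * X]big_mkcond -big_split; congr EFin.
apply: eq_bigr => e _ /=; case: ifPn => eg; first by rewrite g2.
by rewrite gN // eqxx.
Qed.

Lemma prob_state f : P [set w | state w = f] = (\prod_e state_law e (f e))%:E.
Proof.
rewrite (measure_finite_fibers P measurable_edges (measurable_state f)).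
have -> : \prod_e state_law e (f e) =
    \prod_(e : {set 'I_n}) ((if #|e| == 2%N then p * cell_prob (f e) else 0) +
             (if #|e| == 2%N then 1 - p else 1) * (f e == None)%:R).
  by apply: eq_bigr => e _; rewrite /state_law; case: ifP; rewrite ?add0r ?mul1r.
rewrite bigA_distr -sumEFin; apply: eq_bigr => g _; rewrite -prob_edges_state.
by congr (P _); apply/seteqP; split=> w [].
Qed.

Lemma prob_state_pred (E : pred {ffun {set 'I_n} -> option C}) :
  P [set w | E (state w)] = (weight state_law E)%:E.
Proof.
have mE : measurable [set w | E (state w)].
  exact: (measurable_finite_preimage measurable_state (fun f => E f)).
rewrite (measure_finite_fibers P measurable_state mE) -sumEFin; apply: eq_bigr => f _.
have [Ef|Ef] := boolP (E f).
  rewrite mulr1 -prob_state; congr (P _).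
  by apply/seteqP; split=> [w []|w /= sf] //; rewrite sf.
rewrite mulr0 (_ : _ `&` _ = set0) ?measure0 //.
by apply/seteqP; split=> w //= [Ew sf]; move: Ef; rewrite -sf Ew.
Qed.

End State.

End RandomTemporalGraph.

Lemma uniform_prob_itvco (R : realType) (a b c d : R) (ab : a < b) :
  a <= c -> c <= d -> d <= b -> uniform_prob ab `[c, d[%classic = ((d - c) / (b - a))%:E.
Proof.
move=> ac cd db; rewrite /uniform_prob.
rewrite (eq_integral (cst (b - a)^-1%:E)); last first.
  move=> x; rewrite inE /= in_itv /= => /andP[cx xd].
  by rewrite /uniform_pdf (le_trans ac cx) (ltW (lt_le_trans xd db)).
rewrite integral_cst //= lebesgue_measure_itv /= lte_fin; case: ltP => dc.
  by rewrite -EFinD -EFinM mulrC.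
by rewrite mule0 (le_anti (introT andP (conj cd dc))) subrr mul0r.
Qed.

Section TimeCells.
Context {R : realType} (K : nat) (tau : nat -> R).
Hypothesis tau_homo : {homo tau : i j / (i <= j)%N >-> i <= j}.

Definition cell (t : R) : option 'I_K := [pick i : 'I_K | tau i <= t < tau i.+1].

Lemma cell_SomeP t i : cell t = Some i <-> tau i <= t < tau i.+1.
Proof.
rewrite /cell; case: pickP => [j /andP[tj jt]|none]; last by rewrite none.
split=> [[<-]|/andP[ti it]]; first by rewrite tj jt.
congr Some; apply: val_inj => /=; have [ji|ij|//] := ltngtP j i.
  by have := le_lt_trans ti (lt_le_trans jt (tau_homo ji)); rewrite ltxx.
by have := le_lt_trans tj (lt_le_trans it (tau_homo ij)); rewrite ltxx.
Qed.

Lemma cell_lt t t' i j : cell t = Some i -> cell t' = Some j -> (i < j)%N -> t <= t'.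
Proof.
move=> /cell_SomeP/andP[_ ti] /cell_SomeP/andP[jt' _] ij.
exact: le_trans (ltW ti) (le_trans (tau_homo ij) jt').
Qed.

Lemma cell_Some_itv i : [set t | cell t = Some i] = `[tau i, tau i.+1[%classic.
Proof. by apply/seteqP; split=> t /=; rewrite in_itv => /cell_SomeP. Qed.

Lemma measurable_cell y : measurable [set t | cell t = y].
Proof.
case: y => [i|]; first by rewrite cell_Some_itv; exact: measurable_itv.
have -> : [set t | cell t = None] = ~` \bigcup_(i in setT) [set t | cell t = Some i].
  apply/seteqP; split=> t /= ct; first by case=> i _ /=; rewrite ct.
  by case E: (cell t) => [i|//]; case: ct; exists i.
apply: measurableC; apply: fin_bigcup_measurable => [|i _]; first exact: finite_finset.
by rewrite cell_Some_itv; exact: measurable_itv.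
Qed.

Lemma cell_prob_Some i : 0 <= tau 0 -> tau K <= 1 ->
  cell_prob cell (Some i) = tau i.+1 - tau i.
Proof.
move=> tau0 tauK; rewrite /cell_prob cell_Some_itv uniform_prob_itvco ?tau_homo //=.
- by rewrite subr0 divr1.
- exact: le_trans tau0 (tau_homo _).
- exact: le_trans (tau_homo (ltn_ord i)) tauK.
Qed.

End TimeCells.

Section CellsOfWidth.
Context {R : realType} (K : nat) (p : R) (width : nat -> R).
Hypotheses (p_gt0 : 0 < p) (width_ge0 : forall i, 0 <= width i).
Hypothesis width_sum : \sum_(0 <= i < K) width i <= p.

(* A pair is an edge with probability [p], so its label is in a cell of length
   [width i / p] with probability [width i]. *)
Definition breakpoint i : R := (\sum_(0 <= k < i) width k) / p.

Lemma breakpointS i : breakpoint i.+1 - breakpoint i = width i / p.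
Proof. by rewrite /breakpoint big_nat_recr //= mulrDl addrAC subrr add0r. Qed.

Lemma breakpoint_homo : {homo breakpoint : i j / (i <= j)%N >-> i <= j}.
Proof.
apply: homo_leq => // [x y z|i]; first exact: le_trans.
by rewrite -subr_ge0 breakpointS divr_ge0 // ltW.
Qed.

Lemma state_law_insub n (e : {set 'I_n}) i : #|e| = 2%N -> (i < K)%N ->
  state_law p (cell K breakpoint) e (insub i) = width i.
Proof.
move=> e2 iK; rewrite /state_law e2 eqxx insubT mulr0 addr0.
rewrite (cell_prob_Some breakpoint_homo).
- by rewrite /= breakpointS mulrC divfK // gt_eqF.
- by rewrite /breakpoint big_geq // mul0r.
- by rewrite ler_pdivrMr // mul1r.
Qed.

End CellsOfWidth.

Section Slots.
Variable K : nat.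

Definition earlier : rel (option 'I_K) :=
  fun c c' => if (c, c') is (Some i, Some j) then (i < j)%N else false.

Definition slots a l : seq (option 'I_K) := [seq insub i | i <- iota a l].

Lemma mem_slots a l c :
  c \in slots a l -> exists2 i, (a <= i < a + l)%N & c = insub i.
Proof. by case/mapP => i; rewrite mem_iota => iK ->; exists i. Qed.

Lemma pairwise_slots a l : (a + l <= K)%N -> pairwise earlier (slots a l).
Proof.
move=> alK; rewrite pairwise_map; apply: (@sub_in_pairwise _ [pred i | i < K]%N ltn).
- by move=> i j; rewrite !inE => iK jK ij; rewrite /earlier /= !insubT.
- by apply/allP => i; rewrite mem_iota inE; lia.
- by rewrite -sorted_pairwise ?iota_ltn_sorted //; exact: ltn_trans.
Qed.

Lemma uniq_slots a l : (a + l <= K)%N -> uniq (slots a l).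
Proof.
move/pairwise_slots; rewrite uniq_pairwise; apply: sub_pairwise => -[i|] [j|] //= ij.
by apply: contraTneq ij => -[->]; rewrite /earlier ltnn.
Qed.

End Slots.

(** * Probability of an optimal spanner *)

Section SquareSchedule.
Context {R : realType} (N : nat) (h q : R).

(* Cells [0, N) carry the in-forest, [N] and [N + 1] the square, and
   [N + 2, 2 N + 2) the out-forest. *)
Definition num_cells : nat := N + (2 + N).

Definition cell_width (i : nat) : R := if (N <= i < N.+2)%N then q else h.

Definition in_slots : seq (option 'I_num_cells) := rev (slots _ 0 N).

Definition out_slots : seq (option 'I_num_cells) := slots _ N.+2 N.

Definition good_square {V T : finType} (emb : (bool * bool) * T -> V) :=
  good_copy square_succ emb (square_state emb (insub N) (insub N.+1)) in_slots out_slots.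

Lemma cell_width_ge0 i : 0 <= h -> 0 <= q -> 0 <= cell_width i.
Proof. by rewrite /cell_width; case: ifP. Qed.

Lemma cell_width_square i : (N <= i < N.+2)%N -> cell_width i = q.
Proof. by rewrite /cell_width => ->. Qed.

Lemma cell_width_forest i : ~~ (N <= i < N.+2)%N -> cell_width i = h.
Proof. by rewrite /cell_width => /negbTE ->. Qed.

Lemma sum_cell_width : \sum_(0 <= i < num_cells) cell_width i = 2 * (N%:R * h + q).
Proof.
have sum_cst a b (c : R) : (forall i, (a <= i < b)%N -> cell_width i = c) ->
    \sum_(a <= i < b) cell_width i = (b - a)%:R * c.
  by move=> wc; rewrite (eq_big_nat _ _ wc) sumr_const_nat mulr_natl.
rewrite (@big_cat_nat _ _ _ N) ?leq_addr //=.
rewrite (@big_cat_nat _ _ _ N.+2 N) /num_cells /=; [|lia|lia].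
rewrite (sum_cst _ _ h) => [|i iN]; last by apply: cell_width_forest; lia.
rewrite (sum_cst _ _ q) => [|i iN]; last exact: cell_width_square.
rewrite (sum_cst _ _ h) => [|i iN]; last by apply: cell_width_forest; lia.
have -> : (N.+2 - N = 2)%N by lia.
have -> : (N + (2 + N) - N.+2 = N)%N by lia.
by rewrite subn0; ring.
Qed.

Lemma in_slots_cat_out_slots :
  rev in_slots ++ [:: insub N, insub N.+1 & out_slots] = slots num_cells 0 num_cells.
Proof. by rewrite /in_slots revK /slots iotaD map_cat. Qed.

End SquareSchedule.

Section SpannerProbability.
Context d (T : measurableType d) (R : realType) (P : probability T R).
Variables (n : nat) (p : R) (G : T -> tgraph 'I_n R).
Hypothesis FG : is_Fnp P p G.
Variables (m N : nat) (h q : R) (emb : (bool * bool) * 'I_m -> 'I_n).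
Hypotheses (m_gt0 : (0 < m)%N) (emb_inj : injective emb).
Hypotheses (h01 : 0 <= h <= 1) (q01 : 0 < q <= 1) (p01 : 0 < p <= 1).
Hypothesis mass : 2 * (N%:R * h + q) <= p.
Local Notation kappa := (cell (num_cells N) (breakpoint p (cell_width N h q))).

Let width_ge0 i : 0 <= cell_width N h q i.
Proof. by apply: cell_width_ge0; [case/andP: h01|case/andP: q01 => /ltW]. Qed.

Let breakpoints_homo : {homo breakpoint p (cell_width N h q) : i j / (i <= j)%N >-> i <= j}.
Proof. by apply: breakpoint_homo => //; case/andP: p01. Qed.

Let state_law_slot (e : {set 'I_n}) i : #|e| = 2%N -> (i < num_cells N)%N ->
  state_law p kappa e (insub i) = cell_width N h q i.
Proof.
have [p0 _] := andP p01; move=> e2 iK.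
by rewrite state_law_insub // sum_cell_width.
Qed.

Lemma weight_exists_good_square :
  2 * (1 - 2 * (n%:R * (decay n h ^+ N * potential n 4))) - (1 + (m%:R * q)^-1) ^+ 4 <=
  weight (state_law p kappa) (fun s => [exists x, good_square emb x s]).
Proof.
have [p0 p1] := andP p01.
have mkappa := measurable_cell (K := num_cells N) breakpoints_homo.
have law_square x e : e \in copy_edges square_succ emb x ->
    state_law p kappa e (square_state emb (insub N) (insub N.+1) e) = q.
  case/imsetP => j _ ->; have e2 := cards2_copy_edge square_succ_neq emb_inj x j.
  rewrite /square_state; case: ifP => _; rewrite state_law_slot ?cell_width_square //;
    by rewrite /num_cells; lia.
have law_forest (e : {set 'I_n}) c : #|e| = 2%N ->
    c \in in_slots N ++ out_slots N -> h <= state_law p kappa e c.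
  move=> e2; rewrite mem_cat mem_rev => /orP[] /mem_slots[i iN ->];
    rewrite state_law_slot ?cell_width_forest //; rewrite /num_cells; lia.
have size_out : size (out_slots N) = N by rewrite size_map size_iota.
have size_in : size (in_slots N) = size (out_slots N).
  by rewrite size_rev size_out size_map size_iota.
have := weight_exists_good_copy square_succ_neq square_succ2_neq emb_inj _
  (sum_state_law p mkappa) law_square q01 law_forest h01 _ _ size_in.
rewrite size_out card_prod card_bool !card_ord; apply=> //.
- by move=> e y; apply: state_law_ge0; rewrite (ltW p0).
- by rewrite rev_uniq uniq_slots // /num_cells; lia.
- by rewrite uniq_slots // /num_cells; lia.
Qed.

Lemma good_square_optimal_spanner w :
  [exists x, good_square emb x (state G kappa w)] -> has_optimal_spanner (G w).
Proof.
case/existsP => x /(good_square_chains emb_inj).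
rewrite in_slots_cat_out_slots uniq_slots // => /(_ isT)[F [cardF sF chF]].
have edgeF e : e \in F -> e \in edges (G w).
  move/sF/mem_slots => [i iK]; rewrite ffunE; case: ifP => // _.
  by rewrite insubT.
apply: (chains_optimal_spanner (before := @earlier _)) chF => //.
- exact: pairwise_slots.
- by apply/fintype.subsetP.
move=> e e' /edgeF eG /edgeF e'G; rewrite !ffunE eG e'G /earlier.
case ce : (kappa _) => [i|//]; case ce' : (kappa _) => [j|//].
exact: (cell_lt (@breakpoints_homo) ce ce').
Qed.

Lemma prob_has_optimal_spanner_ge :
  ((2 * (1 - 2 * (n%:R * (decay n h ^+ N * potential n 4))) -
    (1 + (m%:R * q)^-1) ^+ 4)%:E <= P [set w | has_optimal_spanner (G w)])%E.
Proof.
have mkappa := measurable_cell (K := num_cells N) breakpoints_homo.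
apply: le_trans (_ : (weight (state_law p kappa)
    (fun s => [exists x, good_square emb x s]))%:E <= _)%E.
  by rewrite lee_fin weight_exists_good_square.
rewrite -(prob_state_pred FG mkappa); apply: le_measure; rewrite ?inE.
- exact: (measurable_finite_preimage (measurable_state FG mkappa)
    (fun f => [exists x, good_square emb x f])).
- exact: (measurable_has_optimal_spanner FG).
- exact: good_square_optimal_spanner.
Qed.

End SpannerProbability.

(** * Asymptotics *)

Lemma decay_expr_le_expR (R : realType) (n N : nat) (h : R) : 0 <= h ->
  decay n h ^+ N <= expR (- (N%:R * ((n%:R - 1) * h / (1 + n%:R ^+ 2 * h)))).
Proof.
move=> h0; rewrite -mulrN expRM_natl.
by rewrite lerXn2r ?nnegrE ?expR_ge0 ?decay_ge0 // expR_ge1Dx.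
Qed.

Lemma growth_exponent_ge (R : realFieldType) (n t : R) : 1 <= n -> 0 <= t <= 1 ->
  n * t - 2 <= (n - 1) * t / (1 + t / n).
Proof.
move=> n1 /andP[t0 t1]; have tn : 0 <= t / n by rewrite divr_ge0 //; lra.
have nE : n * (t / n) = t by rewrite mulrC divfK // gt_eqF //; lra.
rewrite ler_pdivlMr; last lra.
by move: (t / n) tn nE => x; nra.
Qed.

(* With [n ^ 3] cells of mass [h = t / n ^ 3] the correction [n ^ 2 * h] in [decay]
   is only [t / n]. *)
Lemma decay_potential_le (R : realType) (n k : nat) (t : R) :
  (1 < k <= n)%N -> 0 <= t <= 1 ->
  decay n (t / (n ^ 3)%:R) ^+ (n ^ 3) * potential n k <= expR (2 - n%:R * t) * n%:R.
Proof.
move=> kn t01; have [t0 _] := andP t01; have [k1 _] := andP kn.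
have n1 : 1 <= n%:R :> R by rewrite -[1]/(1%:R) ler_nat; case/andP: kn; lia.
have n0 : n%:R != 0 :> R by rewrite gt_eqF //; lra.
have h0 : 0 <= t / (n ^ 3)%:R by rewrite divr_ge0.
rewrite ler_pM ?exprn_ge0 ?decay_ge0 ?potential_ge0 ?potential_le //.
apply: le_trans (decay_expr_le_expR _ _ h0) _; rewrite ler_expR lerNl opprB.
have -> : n%:R ^+ 2 * (t / (n ^ 3)%:R) = t / n%:R by rewrite natrX; field.
rewrite mulrA (mulrCA _ (n%:R - 1)) [(n ^ 3)%:R * _]mulrC divfK ?natrX ?expf_neq0 //.
exact: growth_exponent_ge.
Qed.

Lemma exprn4_1Dinv_le (R : realFieldType) (x L : R) : 2 <= L -> L / 2 <= x ->
  (1 + x^-1) ^+ 4 <= 1 + 30 / L.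
Proof.
move=> L2 Lx; have xV : x^-1 <= 2 / L by rewrite -invf_div lef_pV2 ?posrE //; lra.
have xV0 : 0 <= x^-1 by rewrite invr_ge0; lra.
have xV1 : x^-1 <= 1 by rewrite invf_le1; lra.
have -> : 30 / L = 15 * (2 / L) by ring.
move: (x^-1) (2 / L) xV xV0 xV1 => y z yz y0 y1.
have y2 : y ^+ 2 <= y by nra.
have y3 : y ^+ 3 <= y by rewrite exprS; nra.
have y4 : y ^+ 4 <= y by rewrite exprS; nra.
have -> : (1 + y) ^+ 4 = 1 + 4 * y + 6 * y ^+ 2 + 4 * y ^+ 3 + y ^+ 4 by ring.
lra.
Qed.

Lemma exists_inj_ord (A : finType) (n : nat) : (#|A| <= n)%N ->
  exists f : A -> 'I_n, injective f.
Proof.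
move=> An; exists (fun a => widen_ord An (fintype.enum_rank a)) => a b /(congr1 val) ab.
by apply: fintype.enum_rank_inj; apply: val_inj.
Qed.

Definition log_excess (R : realType) (n : nat) : R := ln n%:R `^ (4 / 5).

Definition phase_mass (R : realType) (n : nat) : R :=
  (2 * ln n%:R + 4 * log_excess R n) / n%:R.

Lemma phase_mass_ge0 (R : realType) (n : nat) : 0 <= phase_mass R n.
Proof.
rewrite divr_ge0 // addr_ge0 // mulr_ge0 ?powR_ge0 //.
by case: n => [|n]; [rewrite ln0|rewrite ln_ge0 // ler1n].
Qed.

Lemma growth_failure_le_inv (R : realType) (n : nat) :
  (4 <= n)%N -> 1 <= log_excess R n -> phase_mass R n <= 1 ->
  n%:R * (decay n (phase_mass R n / (n ^ 3)%:R) ^+ (n ^ 3) * potential n 4) <=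
  (log_excess R n)^-1.
Proof.
move=> n4 L1 t1; have n0 : 0 < n%:R :> R by rewrite ltr0n (leq_trans _ n4).
have t01 : 0 <= phase_mass R n <= 1 by rewrite phase_mass_ge0.
apply: le_trans (ler_wpM2l _ (decay_potential_le (k := 4) n4 t01)) _ => //.
have -> : n%:R * (expR (2 - n%:R * phase_mass R n) * n%:R) =
    (expR (4 * log_excess R n - 2))^-1.
  have nE : n%:R = expR (ln n%:R) :> R by rewrite lnK // posrE.
  rewrite {1 3}nE -!expRD -expRN; congr expR.
  by rewrite /phase_mass; field; rewrite gt_eqF.
rewrite lef_pV2 ?posrE ?expR_gt0 //; last lra.
by apply: le_trans (expR_ge1Dx _); lra.
Qed.

Lemma prob_has_optimal_spanner_ge_inv d (T : measurableType d) (R : realType)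
    (P : probability T R) (n : nat) (p : R) (G : T -> tgraph 'I_n R) :
  is_Fnp P p G -> p <= 1 -> (8 <= n)%N -> 2 <= log_excess R n ->
  4 * ln n%:R / n%:R + epsilon R n <= p ->
  ((1 - 34 / log_excess R n)%:E <= P [set w | has_optimal_spanner (G w)])%E.
Proof.
move=> FG p1 n8; pose m := (n %/ 4)%N; have m0 : (0 < m)%N by rewrite /m; lia.
have mn : (n <= m * 8)%N by rewrite /m; lia.
have [emb emb_inj] : exists emb : (bool * bool) * 'I_m -> 'I_n, injective emb.
  by apply: exists_inj_ord; rewrite !card_prod card_bool card_ord mulnC leq_divM.
rewrite /epsilon -/(log_excess R n); set L := log_excess R n => L2 hp.
have n0 : 0 < n%:R :> R by rewrite ltr0n (leq_trans _ n8).
have t0 := phase_mass_ge0 R n; set t := phase_mass R n in t0.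
pose q : R := 4 * L / n%:R; have q0 : 0 < q by rewrite divr_gt0 //; lra.
have tq : 2 * (t + q) <= p.
  apply: le_trans hp; rewrite le_eqVlt; apply/orP; left; apply/eqP.
  by rewrite /t /phase_mass -/L /q; field; rewrite gt_eqF.
have [L1 t1] : 1 <= L /\ t <= 1 by split; lra.
have N1 : 1 <= (n ^ 3)%:R :> R by rewrite ler1n expn_gt0 (leq_trans _ n8).
have h01 : 0 <= t / (n ^ 3)%:R <= 1 by rewrite divr_ge0 //= ler_pdivrMr; lra.
have mq : L / 2 <= m%:R * q.
  have -> : L / 2 = n%:R / 8 * q by rewrite /q; field; rewrite gt_eqF.
  by rewrite ler_wpM2r ?(ltW q0) // ler_pdivrMr // -natrM ler_nat.
apply: le_trans (prob_has_optimal_spanner_ge FG (N := n ^ 3) (q := q) m0 emb_inj h01 _ _ _).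
- have := exprn4_1Dinv_le L2 mq.
  have : n%:R * (decay n (t / (n ^ 3)%:R) ^+ (n ^ 3) * potential n 4) <= L^-1.
    by apply: growth_failure_le_inv L1 t1; exact: leq_trans n8.
  by rewrite lee_fin (_ : 34 / L = 4 * L^-1 + 30 / L); [lra|ring].
- by rewrite q0; lra.
- by rewrite p1 andbT; lra.
- by rewrite [(n ^ 3)%:R * _]mulrC divfK // gt_eqF //; lra.
Qed.

Lemma powR_cvgy (R : realType) (a : R) : 0 < a -> x `^ a @[x --> +oo] --> +oo.
Proof.
move=> a0; apply/cvgryPge => A.
pose B := Num.max A 0; have B0 : 0 <= B by rewrite le_max lexx orbT.
near=> x; apply: (@le_trans _ _ B); first by rewrite le_max lexx.
have -> : B = (B `^ a^-1) `^ a by rewrite -powRrM mulVf ?gt_eqF // powRr1.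
have Bx : B `^ a^-1 <= x by near: x; exact: nbhs_pinfty_ge.
have x0 : 0 <= x := le_trans (powR_ge0 _ _) Bx.
by apply: ge0_ler_powR => //; rewrite ?nnegrE ?powR_ge0 ?(ltW a0).
Unshelve. all: by end_near. Qed.

Lemma ln_cvgy (R : realType) : ln x @[x --> +oo] --> (+oo : set_system R).
Proof.
apply/cvgryPge => A; near=> x.
have Ax : expR A <= x by near: x; exact: nbhs_pinfty_ge.
by rewrite -[A]expRK ler_ln ?posrE ?expR_gt0 // (lt_le_trans _ Ax) ?expR_gt0.
Unshelve. all: by end_near. Qed.

Lemma log_excess_cvgy (R : realType) : log_excess R n @[n --> \oo] --> +oo.
Proof.
apply: cvg_comp (cvg_comp _ _ (@cvgr_idn R) (@ln_cvgy R)) (@powR_cvgy R _ _).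
by rewrite divr_gt0.
Qed.

Unset Implicit Arguments.

Theorem theorem5p7 (R : realType) (p : nat -> R)
  (hp01 : forall n : nat, 0 <= p n <= 1)
  (hp : \forall n \near \oo, 4 * ln n%:R / n%:R + epsilon R n <= p n)
  (d : nat -> measure_display) (T : forall n : nat, measurableType (d n))
  (P : forall n : nat, probability (T n) R)
  (G : forall n : nat, T n -> tgraph 'I_n R)
  (hG : forall n : nat, is_Fnp (P n) (p n) (G n)) :
  P n [set w | has_optimal_spanner (G n w)] @[n --> \oo] --> 1%E.
Proof.
pose L := log_excess R; have Loo : L n @[n --> \oo] --> +oo := @log_excess_cvgy R.
have L2 : \forall n \near \oo, 2 <= L n by move/cvgryPge : Loo; exact.
have low : (1 - 34 / L n)%:E @[n --> \oo] --> 1%E.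
  have LV : (L n)^-1 @[n --> \oo] --> (0 : R).
    by apply/gtr0_cvgV0 => //; near=> n; apply: (@lt_le_trans _ _ 2) => //; near: n.
  apply: cvg_EFin; first by near=> n.
  rewrite -[X in _ --> X]subr0 -(mulr0 34).
  by apply: cvgB; [exact: cvg_cst|apply: cvgM LV; exact: cvg_cst].
apply: (squeeze_cvge _ low); last exact: cvg_cst.
near=> n; apply/andP; split; last first.
  exact/probability_le1/(measurable_has_optimal_spanner (hG n)).
apply: (prob_has_optimal_spanner_ge_inv (hG n)).
- by case/andP: (hp01 n).
- by near: n; exact: nbhs_infty_ge.
- by near: n.
- by near: n.
Unshelve. all: by end_near. Qed.
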